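(* Consider Heisenberg space $\mathrm{Nil}_3=\mathbb{E}(0,\tau)$, $\tau>0$, and suppose the pitch $a$ is admissible, i.e. $a>\frac{1}{2\tau}$. Then there exists a value $\mathcal{H}_a^{\mathrm{Nil}}$ such that for each $H>\mathcal{H}_a^{\mathrm{Nil}}$ there exists exactly one (screw motion) tube with constant mean curvature $H$ around the geodesic $c_a$.
   Context: $\mathrm{Nil}_3=\mathbb{E}(0,\tau)$ (away from the fiber over $r=0$) has coordinates $r\in(0,\infty)$, $\theta\in[0,2\pi)$ (modulo $2\pi$), $z\in\mathbb{R}$ with metric $dr^2+r^2d\theta^2+(\tau r^2\,d\theta-dz)^2$. The screw motion group of pitch $a$ is $G_a=\{(r,\theta,z)\mapsto(r,\theta+s,z+as):s\in\mathbb{R}\}$. For $a>\frac1{2\tau}$, $c_a(s)=(\rho_a,s,as)$ with $\rho_a^2=\frac{2a\tau-1}{2\tau^2}$ is a geodesic orbit of $G_a$. For $H>0$, $J<0$ and $\sigma\in\mathbb{R}$ let $r(\sigma)>0$ be the unique positive solution of $-Hr^2+r\sin\sigma=J$ and $$h_a(\sigma)=\int_{\pi/2}^\sigma\frac{dh}{d\sigma}\,d\sigma,\qquad \frac{dh}{d\sigma}=\frac{\sqrt{r^2+(\tau r^2-a)^2}}{2Hr-\sin\sigma}\,\sin\sigma .$$ The screw motion surface $\Sigma_a(H,J)=\{(r(\sigma),s,h_a(\sigma)+as):\sigma,s\in\mathbb{R}\}$ is $G_a$-invariant and has constant mean curvature $H$. $\Sigma_a(H,J)$ is a (screw motion) tube,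 around $c_a$, if its profile curve $\sigma\mapsto(r(\sigma),h_a(\sigma))$ is a simple closed curve, equivalently if $\delta_a(H,J):=\int_{\pi/2}^{3\pi/2}\frac{dh}{d\sigma}d\sigma=0$. Surfaces are counted up to vertical translation (isometry), so ''exactly one tube'' means exactly one value $J<0$ with $\delta_a(H,J)=0$. *)

(* Defs.v *)
From Stdlib Require Import Reals Lra Psatz.
From Coquelicot Require Import Coquelicot.
Open Scope R_scope.

(** Cylindrical coordinates [(r, theta, z)] on Nil_3 = E(0, tau), with metric
    [dr^2 + r^2 dtheta^2 + (tau r^2 dtheta - dz)^2].  For [H > 0] and [J < 0],
    the screw motion surface of pitch [a], constant mean curvature [H] and
    first integral [J] is the image of
    [(sigma, s) |-> (profile_r H J sigma, s, profile_h tau a H J sigma + a * s)]. *)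

(** [iota] is definite description; existence and uniqueness of the root is
    [profile_radius_unique] below. *)
Definition profile_radius (H J sigma r : R) : Prop :=
  0 < r /\ - H * r ^ 2 + r * sin sigma = J.

Definition profile_r (H J sigma : R) : R :=
  iota (fun r : R => profile_radius H J sigma r).

Definition profile_dh (tau a H J sigma : R) : R :=
  let r := profile_r H J sigma in
  sqrt (r ^ 2 + (tau * r ^ 2 - a) ^ 2) / (2 * H * r - sin sigma) * sin sigma.

Definition profile_h (tau a H J sigma : R) : R :=
  RInt (fun t => profile_dh tau a H J t) (PI / 2) sigma.

Definition profile_curve (tau a H J sigma : R) : R * R :=
  (profile_r H J sigma, profile_h tau a H J sigma).

Definition simple_closed_curve (gamma : R -> R * R) : Prop :=
  (forall t : R, continuous gamma t) /\
  exists T : R,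
    0 < T /\
    (forall t : R, gamma (t + T) = gamma t) /\
    (forall s t : R, 0 <= s < T -> 0 <= t < T -> gamma s = gamma t -> s = t).

Definition is_tube (tau a H J : R) : Prop :=
  simple_closed_curve (profile_curve tau a H J).

Lemma profile_radius_unique (H J sigma : R) :
  0 < H -> J < 0 -> exists! r : R, profile_radius H J sigma r.
Proof.
intros HH HJ.
assert (HD : 0 < (sin sigma) ^ 2 - 4 * H * J) by nra.
set (d := sqrt ((sin sigma) ^ 2 - 4 * H * J)).
assert (Hd : d * d = (sin sigma) ^ 2 - 4 * H * J) by (apply sqrt_sqrt; lra).
assert (Hd0 : 0 < d) by (apply sqrt_lt_R0; exact HD).
assert (Hpos : 0 < sin sigma + d) by nra.
exists ((sin sigma + d) / (2 * H)); split.
- split.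
  + apply Rdiv_lt_0_compat; lra.
  + replace J with (((sin sigma) ^ 2 - d * d) / (4 * H))
      by (rewrite Hd; field; lra).
    field; lra.
- intros r [Hr Er].
  assert (E : (2 * H * r - sin sigma - d) * (2 * H * r - sin sigma + d) = 0)
    by nra.
  destruct (Rmult_integral _ _ E) as [E1 | E1].
  + replace (sin sigma + d) with (2 * H * r) by lra; field; lra.
  + exfalso; nra.
Qed.

Lemma profile_rP (H J sigma : R) :
  0 < H -> J < 0 -> profile_radius H J sigma (profile_r H J sigma).
Proof.
intros HH HJ.
exact (iota_correct (V := R_CompleteNormedModule) _
         (profile_radius_unique H J sigma HH HJ)).
Qed.

(* Main.v *)
(** With [q = -4HJ], folding the closing integral onto [0, pi/2] writes it as a
    positive multiple of the integral of
    [s^2 (2 s^2 + q - c) / (F(r_+) + F(r_-))], where [s = sin u],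
    [c = 4 H^2 rho_a^2], [F] is the length of the Killing field of [G_a], and
    [r_+], [r_-] are the radii for [s] and [-s].  It is negative for
    [q <= c - 2] and positive for [q >= c], so it vanishes somewhere in between.
    On [c - 2, c] the factor [2 s^2 + q - c] is bounded by 2, whereas the relative
    variation of the denominator with [q] is [O(1 / H^2)]; for large [H] the
    integrand is therefore strictly increasing in [q], and the zero is unique. *)

Require Import Defs.
From Stdlib Require Import ZArith Reals Lra Psatz.
From Coquelicot Require Import Coquelicot.
Open Scope R_scope.

(** * Primitives of functions of the sine *)

(** For [f] the slope of the profile as a function of [sin sigma], this is its height. The facts
    below use only continuity of [f] and, later, that [f s] has the sign of [s]. *)
Definition sin_primitive (f : R -> R) (sigma : R) : R :=
  RInt (fun t => f (sin t)) (PI / 2) sigma.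

Lemma continuous_comp_sin (f : R -> R) (t : R) :
  (forall s, continuous f s) -> continuous (fun u => f (sin u)) t.
Proof.
intros Hf. apply continuous_comp; [apply continuous_sin | apply Hf].
Qed.

Lemma ex_RInt_comp_sin (f : R -> R) (x y : R) :
  (forall s, continuous f s) -> ex_RInt (fun u => f (sin u)) x y.
Proof.
intros Hf. apply (ex_RInt_continuous (V := R_CompleteNormedModule)).
intros z _. now apply continuous_comp_sin.
Qed.

Lemma RInt_comp_sin_Chasles (f : R -> R) (x y z : R) :
  (forall s, continuous f s) ->
  RInt (fun u => f (sin u)) x z =
  RInt (fun u => f (sin u)) x y + RInt (fun u => f (sin u)) y z.
Proof.
intros Hf. symmetry.
apply (RInt_Chasles (V := R_CompleteNormedModule)); now apply ex_RInt_comp_sin.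
Qed.

Lemma RInt_comp_sin_reflect (f : R -> R) (x y : R) :
  (forall s, continuous f s) ->
  RInt (fun u => f (sin u)) (PI - x) (PI - y) =
  - RInt (fun u => f (sin u)) x y.
Proof.
intros Hf.
replace (PI - x) with (-1 * x + PI) by ring.
replace (PI - y) with (-1 * y + PI) by ring.
rewrite <- (RInt_comp_lin (V := R_CompleteNormedModule)
              (fun u => f (sin u)) (-1) PI x y)
  by now apply ex_RInt_comp_sin.
rewrite <- (RInt_opp (V := R_CompleteNormedModule))
  by now apply ex_RInt_comp_sin.
apply (RInt_ext (V := R_CompleteNormedModule)); intros u _.
replace (-1 * u + PI) with (PI - u) by ring; rewrite sin_PI_x.
unfold scal, opp; simpl; unfold mult; simpl. ring.
Qed.

Lemma RInt_comp_sin_shift (f : R -> R) (x y : R) :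
  (forall s, continuous f s) ->
  RInt (fun u => f (sin u)) (x + 2 * PI) (y + 2 * PI) =
  RInt (fun u => f (sin u)) x y.
Proof.
intros Hf.
replace (x + 2 * PI) with (1 * x + 2 * PI) by ring.
replace (y + 2 * PI) with (1 * y + 2 * PI) by ring.
rewrite <- (RInt_comp_lin (V := R_CompleteNormedModule)
              (fun u => f (sin u)) 1 (2 * PI) x y)
  by now apply ex_RInt_comp_sin.
apply (RInt_ext (V := R_CompleteNormedModule)); intros u _.
replace (1 * u + 2 * PI) with (u + 2 * INR 1 * PI) by (simpl; ring).
rewrite sin_period. unfold scal; simpl; unfold mult; simpl. ring.
Qed.

Lemma RInt_comp_sin_half_turn (f : R -> R) (x y : R) :
  (forall s, continuous f s) ->
  RInt (fun u => f (sin u)) (x + PI) (y + PI) =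
  RInt (fun u => f (- sin u)) x y.
Proof.
intros Hf.
replace (x + PI) with (1 * x + PI) by ring.
replace (y + PI) with (1 * y + PI) by ring.
rewrite <- (RInt_comp_lin (V := R_CompleteNormedModule)
              (fun u => f (sin u)) 1 PI x y)
  by now apply ex_RInt_comp_sin.
apply (RInt_ext (V := R_CompleteNormedModule)); intros u _.
replace (1 * u + PI) with (u + PI) by ring.
rewrite neg_sin. unfold scal; simpl; unfold mult; simpl. ring.
Qed.

(** The reflection [sigma -> PI - sigma] preserves the sine and fixes the base point [PI / 2], so
    the primitive is odd about it. *)
Lemma sin_primitive_reflect (f : R -> R) (sigma : R) :
  (forall s, continuous f s) ->
  sin_primitive f (PI - sigma) = - sin_primitive f sigma.
Proof.
intros Hf. unfold sin_primitive.
rewrite <- RInt_comp_sin_reflect by assumption. f_equal. lra.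
Qed.

(** The increment over a full turn does not depend on the starting point; starting at [PI / 2],
    reflection shows that the two half turns contribute equally. *)
Lemma sin_primitive_turn (f : R -> R) (sigma : R) :
  (forall s, continuous f s) ->
  sin_primitive f (sigma + 2 * PI) =
  sin_primitive f sigma + 2 * sin_primitive f (3 * PI / 2).
Proof.
intros Hf.
assert (E : sin_primitive f (sigma + 2 * PI) =
  sin_primitive f (PI / 2 + 2 * PI) + sin_primitive f sigma).
{ unfold sin_primitive at 1.
  rewrite (RInt_comp_sin_Chasles f _ (PI / 2 + 2 * PI)) by assumption.
  now rewrite RInt_comp_sin_shift. }
rewrite E.
assert (E2 : sin_primitive f (PI / 2 + 2 * PI) =
  sin_primitive f (3 * PI / 2) - sin_primitive f (PI - 3 * PI / 2)).
{ unfold sin_primitive at 1.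
  rewrite (RInt_comp_sin_Chasles f _ (3 * PI / 2)) by assumption.
  fold (sin_primitive f (3 * PI / 2)).
  replace (3 * PI / 2) with (PI - 3 * PI / 2 + 2 * PI) at 2 by lra.
  rewrite RInt_comp_sin_shift by assumption.
  rewrite <- (opp_RInt_swap (V := R_CompleteNormedModule))
    by now apply ex_RInt_comp_sin.
  reflexivity. }
rewrite E2, sin_primitive_reflect by assumption. ring.
Qed.

Lemma sin_primitive_turns (f : R -> R) (sigma : R) (n : nat) :
  (forall s, continuous f s) ->
  sin_primitive f (sigma + 2 * INR n * PI) =
  sin_primitive f sigma + 2 * INR n * sin_primitive f (3 * PI / 2).
Proof.
intros Hf. induction n as [|n IH].
- simpl. replace (sigma + 2 * 0 * PI) with sigma by ring. ring.
- rewrite S_INR.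
  replace (sigma + 2 * (INR n + 1) * PI) with (sigma + 2 * INR n * PI + 2 * PI)
    by ring.
  rewrite sin_primitive_turn, IH by assumption. ring.
Qed.

(** Split at [PI]: reflection carries the first quarter to [[0, PI / 2]], and a half turn carries
    the second one there while changing the sign of the sine. *)
Lemma sin_primitive_half_turn (f : R -> R) :
  (forall s, continuous f s) ->
  sin_primitive f (3 * PI / 2) =
  RInt (fun u => f (sin u) + f (- sin u)) 0 (PI / 2).
Proof.
intros Hf.
assert (Hf' : forall s, continuous (fun s => f (- s)) s).
{ intros s. apply (continuous_comp (fun s => - s) f);
  [apply (continuous_opp (V := R_NormedModule)); apply continuous_id
  | apply Hf]. }
unfold sin_primitive.
rewrite (RInt_comp_sin_Chasles f _ PI) by assumption.
replace (RInt (fun u => f (sin u)) (PI / 2) PI)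
  with (RInt (fun u => f (sin u)) (PI - PI / 2) (PI - 0)) by (f_equal; lra).
rewrite RInt_comp_sin_reflect by assumption.
replace (RInt (fun u => f (sin u)) PI (3 * PI / 2))
  with (RInt (fun u => f (sin u)) (0 + PI) (PI / 2 + PI)) by (f_equal; lra).
rewrite RInt_comp_sin_half_turn by assumption.
assert (E : RInt (fun u => f (sin u) + f (- sin u)) 0 (PI / 2) =
  RInt (fun u => f (sin u)) 0 (PI / 2) + RInt (fun u => f (- sin u)) 0 (PI / 2)).
{ apply (RInt_plus (V := R_CompleteNormedModule)).
  - now apply ex_RInt_comp_sin.
  - now apply (ex_RInt_comp_sin (fun s => f (- s))). }
rewrite E, <- (opp_RInt_swap (V := R_CompleteNormedModule))
  by now apply ex_RInt_comp_sin.
unfold opp; simpl. ring.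
Qed.

(** * Sign and zeros of the primitive, and closed curves *)

Lemma continuous_sin_primitive (f : R -> R) (sigma : R) :
  (forall s, continuous f s) -> continuous (sin_primitive f) sigma.
Proof.
intros Hf.
apply (continuous_RInt_1 (V := R_NormedModule) (fun u => f (sin u)) (PI / 2)).
apply filter_forall; intros z.
apply (RInt_correct (V := R_CompleteNormedModule)).
now apply ex_RInt_comp_sin.
Qed.

(** The primitive increases from 0 up to [PI], then decreases to its value 0 at [3 * PI / 2]. *)
Lemma sin_primitive_gt_0 (f : R -> R) (sigma : R) :
  (forall s, continuous f s) ->
  (forall s, 0 < s -> 0 < f s) -> (forall s, s < 0 -> f s < 0) ->
  sin_primitive f (3 * PI / 2) = 0 ->
  PI / 2 < sigma < 3 * PI / 2 -> 0 < sin_primitive f sigma.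
Proof.
intros Hf Hpos Hneg H0 Hs.
assert (HPI := PI_RGT_0).
destruct (Rle_lt_dec sigma PI) as [Hle | Hlt].
- apply RInt_gt_0.
  + lra.
  + intros x Hx. apply Hpos, sin_gt_0; lra.
  + intros x _. now apply continuous_comp_sin.
- unfold sin_primitive in *.
  rewrite (RInt_comp_sin_Chasles f _ sigma) in H0 by assumption.
  assert (P : 0 < RInt (fun u => - f (sin u)) sigma (3 * PI / 2)).
  { apply RInt_gt_0.
    - lra.
    - intros x Hx. assert (f (sin x) < 0) by (apply Hneg, sin_lt_0; lra). lra.
    - intros x _. apply (continuous_opp (V := R_NormedModule)).
      now apply continuous_comp_sin. }
  rewrite (RInt_opp (V := R_CompleteNormedModule) (fun u => f (sin u))) in P
    by now apply ex_RInt_comp_sin.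
  unfold opp in P; simpl in P. lra.
Qed.

(** Outside [[PI / 2, 3 * PI / 2]], reflection moves [t], up to a full turn, into the interval of
    positivity, so the primitive is negative at [t]. *)
Lemma sin_primitive_eq_0 (f : R -> R) (t : R) :
  (forall s, continuous f s) ->
  (forall s, 0 < s -> 0 < f s) -> (forall s, s < 0 -> f s < 0) ->
  sin_primitive f (3 * PI / 2) = 0 ->
  0 <= t < 2 * PI -> sin_primitive f t = 0 -> t = PI / 2 \/ t = 3 * PI / 2.
Proof.
intros Hf Hpos Hneg H0 Ht E.
assert (HPI := PI_RGT_0).
assert (P := fun s => sin_primitive_gt_0 f s Hf Hpos Hneg H0).
assert (R1 := sin_primitive_reflect f t Hf).
destruct (Rtotal_order t (PI / 2)) as [L | [-> | L]]; [| now left |].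
- specialize (P (PI - t)). lra.
- destruct (Rtotal_order t (3 * PI / 2)) as [L' | [-> | L']]; [| now right |].
  + specialize (P t). lra.
  + assert (R2 := sin_primitive_turn f (PI - t) Hf).
    specialize (P (PI - t + 2 * PI)). lra.
Qed.

(* A common period is a multiple of [2 * PI] because of the first component, and
   over [n] full turns the primitive gains [2 * n] times its half-turn increment. *)
Lemma simple_closed_curve_sin (rho f : R -> R) :
  (forall s, continuous rho s) -> (forall s, continuous f s) ->
  (forall s t, rho s = rho t -> s = t) ->
  (forall s, 0 < s -> 0 < f s) -> (forall s, s < 0 -> f s < 0) ->
  simple_closed_curve (fun t => (rho (sin t), sin_primitive f t)) <->
  sin_primitive f (3 * PI / 2) = 0.
Proof.
intros Hrho Hf Hinj Hpos Hneg.
assert (HPI := PI_RGT_0).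
split.
- intros [_ [T [HT [Hper _]]]].
  (* The points [- (T / 2)] and [T / 2] differ by one period and have opposite sines; injectivity of
     [rho] makes these sines equal, hence zero. *)
  assert (S : sin (T / 2) = 0).
  { assert (E := f_equal fst (Hper (- (T / 2)))). simpl in E.
    apply Hinj in E.
    replace (- (T / 2) + T) with (T / 2) in E by field.
    rewrite sin_neg in E. lra. }
  destruct (sin_eq_0_0 _ S) as [k Hk].
  assert (Hk0 : (0 < k)%Z).
  { apply lt_IZR. apply (Rmult_lt_reg_r PI); lra. }
  assert (Hn : IZR k = INR (Z.to_nat k)).
  { rewrite INR_IZR_INZ, Z2Nat.id by lia. reflexivity. }
  assert (E := f_equal snd (Hper 0)). simpl in E.
  replace (0 + T) with (0 + 2 * INR (Z.to_nat k) * PI) in E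
    by (rewrite <- Hn; lra).
  rewrite sin_primitive_turns in E by assumption.
  rewrite <- Hn in E. apply IZR_lt in Hk0.
  assert (E' : IZR k * sin_primitive f (3 * PI / 2) = 0) by lra.
  apply Rmult_integral in E'. lra.
- intros H0. split.
  + intros t.
    apply (continuous_comp_2 (fun t => rho (sin t)) (sin_primitive f)
             (fun x y => (x, y))).
    * now apply continuous_comp_sin.
    * now apply continuous_sin_primitive.
    * apply (continuous_ext (fun z : R * R => z)).
      -- now intros [x y].
      -- apply continuous_id.
  + exists (2 * PI). split; [lra | split].
    * intros t. rewrite sin_primitive_turn, H0 by assumption.
      replace (t + 2 * PI) with (t + 2 * INR 1 * PI) by (simpl; ring).
      rewrite sin_period. f_equal. ring.
    * intros s t Hs Ht E. injection E as E1 E2. apply Hinj in E1.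
      assert (Z := fun t => sin_primitive_eq_0 f t Hf Hpos Hneg H0).
      assert (R1 := sin_primitive_reflect f t Hf).
      assert (R2 := sin_primitive_turn f (PI - t) Hf).
      (* Equal sines leave [s = t] or a reflected pair [s + t = PI], [s + t = 3 * PI]. A reflected
         pair has opposite heights; being equal, both vanish, so [s] and [t] lie in
         [{PI / 2, 3 * PI / 2}], and the value of the sum forces [s = t]. *)
      assert (F := form4 s t).
      assert (F0 : 2 * cos ((s + t) / 2) * sin ((s - t) / 2) = 0) by lra.
      apply Rmult_integral in F0 as [F0 | F0].
      -- destruct (cos_eq_0_0 ((s + t) / 2)) as [k Hk]; [lra |].
         assert (K1 : (-1 < k)%Z).
         { apply lt_IZR. apply (Rmult_lt_reg_r PI); lra. }
         assert (K2 : (k < 2)%Z).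
         { apply lt_IZR. apply (Rmult_lt_reg_r PI); lra. }
         assert (K : k = 0%Z \/ k = 1%Z) by lia.
         assert (Zt := Z t Ht). assert (Zs := Z s Hs).
         destruct K as [-> | ->].
         ++ replace s with (PI - t) in * by lra. lra.
         ++ replace s with (PI - t + 2 * PI) in * by lra. lra.
      -- destruct (sin_eq_0_0 _ F0) as [k Hk].
         assert (K1 : (-1 < k)%Z).
         { apply lt_IZR. apply (Rmult_lt_reg_r PI); lra. }
         assert (K2 : (k < 1)%Z).
         { apply lt_IZR. apply (Rmult_lt_reg_r PI); lra. }
         assert (k = 0%Z) as -> by lia. lra.
Qed.

(** * Continuity in parameters *)

(** Compactness of [[a, b]] makes [f y] uniformly close to [f c] for [y] near [c]. *)
Lemma continuous_RInt_param (f : R -> R -> R) (a b c : R) :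
  a <= b ->
  locally c (fun y => ex_RInt (f y) a b) ->
  (forall x, a <= x <= b -> continuity_2d_pt f c x) ->
  continuous (fun y => RInt (f y) a b) c.
Proof.
intros Hab Hex Hf. apply filterlim_locally. intros eps.
assert (Hc := locally_singleton _ _ Hex).
(* The extra 1 covers [a = b] and makes the final estimate strict. *)
assert (He : 0 < eps / (b - a + 1)).
{ apply Rdiv_lt_0_compat; [apply cond_pos | lra]. }
destruct (uniform_continuity_2d_1d' f a b c Hf (mkposreal _ He)) as [d Hd].
simpl in Hd.
assert (Hball : locally c (fun y => Rabs (y - c) < d)).
{ exists d. intros y Hy. exact Hy. }
generalize (filter_and _ _ Hex Hball). apply filter_imp.
intros y [Ey Hy]. unfold ball; simpl; unfold AbsRing_ball, abs, minus, plus, opp.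
simpl.
replace (RInt (f y) a b + - RInt (f c) a b)
  with (RInt (fun x => f y x - f c x) a b)
  by exact (RInt_minus (V := R_CompleteNormedModule) _ _ a b Ey Hc).
apply Rle_lt_trans with ((b - a) * (eps / (b - a + 1))).
- apply abs_RInt_le_const.
  + exact Hab.
  + exact (ex_RInt_minus (V := R_NormedModule) _ _ a b Ey Hc).
  + intros t Ht. apply Rlt_le, Hd; try assumption.
    * split; assert (0 < d) by apply cond_pos; lra.
    * apply Rabs_def2 in Hy. lra.
    * rewrite Rminus_diag, Rabs_R0. apply cond_pos.
- assert (E : (b - a) * (eps / (b - a + 1)) = eps - eps / (b - a + 1))
    by (field; lra).
  lra.
Qed.

Lemma continuity_2d_pt_sqrt (f : R -> R -> R) (x y : R) :
  continuity_2d_pt f x y -> continuity_2d_pt (fun u v => sqrt (f u v)) x y.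
Proof.
intros Hf. apply continuity_1d_2d_pt_comp; [| exact Hf].
apply continuity_pt_filterlim, continuous_sqrt.
Qed.

Lemma continuity_2d_pt_sqr (f : R -> R -> R) (x y : R) :
  continuity_2d_pt f x y -> continuity_2d_pt (fun u v => f u v ^ 2) x y.
Proof.
intros Hf. apply (continuity_2d_pt_ext (fun u v => f u v * f u v)).
- intros; ring.
- now apply continuity_2d_pt_mult.
Qed.

Lemma continuity_2d_pt_section (f : R -> R -> R) (x y : R) :
  continuity_2d_pt f x y -> continuous (f x) y.
Proof.
intros Hf. apply continuity_2d_pt_filterlim in Hf.
apply (continuous_comp_2 (fun _ => x) (fun v => v) f).
- apply continuous_const.
- apply continuous_id.
- exact Hf.
Qed.

(** * The profile curve and the closing condition *)

(* With [q = -4HJ] and [s = sin sigma], this is the radius [r(sigma)], and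
   [2 H r - sin sigma = sqrt (s^2 + q)]. *)
Definition radius (H q s : R) : R := (s + sqrt (s ^ 2 + q)) / (2 * H).

(** The length of the Killing field of [G_a] at radius [r], written [F] in the overview. *)
Definition orbit_speed (tau a r : R) : R := sqrt (r ^ 2 + (tau * r ^ 2 - a) ^ 2).

Definition height_slope (tau a H q s : R) : R :=
  orbit_speed tau a (radius H q s) / sqrt (s ^ 2 + q) * s.

Lemma sqrt_sqr_add_gt_0 (q s : R) : 0 < q -> 0 < sqrt (s ^ 2 + q).
Proof. intros Hq. apply sqrt_lt_R0. nra. Qed.

Lemma sqrt_sqr_add_sqr (q s : R) :
  0 < q -> sqrt (s ^ 2 + q) * sqrt (s ^ 2 + q) = s ^ 2 + q.
Proof. intros Hq. apply sqrt_sqrt. nra. Qed.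

Lemma radius_gt_0 (H q s : R) : 0 < H -> 0 < q -> 0 < radius H q s.
Proof.
intros HH Hq.
assert (d0 := sqrt_sqr_add_gt_0 q s Hq). assert (dd := sqrt_sqr_add_sqr q s Hq).
apply Rdiv_lt_0_compat; [nra | lra].
Qed.

Lemma profile_radius_radius (H J sigma : R) :
  0 < H -> J < 0 ->
  profile_radius H J sigma (radius H (- 4 * H * J) (sin sigma)).
Proof.
intros HH HJ.
assert (Hq : 0 < - 4 * H * J) by nra.
split; [now apply radius_gt_0 |].
assert (dd := sqrt_sqr_add_sqr _ (sin sigma) Hq).
unfold radius. set (d := sqrt _) in *. set (s := sin sigma) in *.
replace (- H * ((s + d) / (2 * H)) ^ 2 + (s + d) / (2 * H) * s)
  with ((s ^ 2 - d * d) / (4 * H)) by (field; lra).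
rewrite dd. field. lra.
Qed.

Lemma profile_rE (H J sigma : R) :
  0 < H -> J < 0 -> profile_r H J sigma = radius H (- 4 * H * J) (sin sigma).
Proof.
intros HH HJ.
destruct (profile_radius_unique H J sigma HH HJ) as [r [_ U]].
rewrite <- (U _ (profile_rP H J sigma HH HJ)).
exact (U _ (profile_radius_radius H J sigma HH HJ)).
Qed.

Lemma profile_dhE (tau a H J sigma : R) :
  0 < H -> J < 0 ->
  profile_dh tau a H J sigma = height_slope tau a H (- 4 * H * J) (sin sigma).
Proof.
intros HH HJ. unfold profile_dh, height_slope, orbit_speed; cbv zeta.
rewrite profile_rE by assumption.
do 2 f_equal. unfold radius. field. lra.
Qed.

Lemma radius_inj (H q s t : R) :
  0 < H -> 0 < q -> radius H q s = radius H q t -> s = t.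
Proof.
intros HH Hq E.
(* The first integral [- H * r ^ 2 + r * s = J] with [J = - q / (4 * H)], solved for [s]: the radius
   determines the sine. *)
assert (Q : forall s, s = H * radius H q s - q / (4 * H * radius H q s)).
{ intros u. assert (Pu := radius_gt_0 H q u HH Hq).
  assert (dd := sqrt_sqr_add_sqr q u Hq).
  assert (e : sqrt (u ^ 2 + q) = 2 * H * radius H q u - u)
    by (unfold radius; field; lra).
  rewrite e in dd.
  set (r := radius H q u) in *. clearbody r.
  assert (e2 : q = 4 * H * r * (H * r - u)) by lra.
  rewrite e2. field. lra. }
rewrite (Q s), (Q t), E. reflexivity.
Qed.

Lemma orbit_speed_gt_0 (tau a r : R) : 0 < r -> 0 < orbit_speed tau a r.
Proof.
intros Hr. apply sqrt_lt_R0.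
assert (0 < r ^ 2) by nra. assert (0 <= (tau * r ^ 2 - a) ^ 2) by apply pow2_ge_0.
lra.
Qed.

Lemma continuity_2d_pt_radius (H q s : R) :
  0 < H -> continuity_2d_pt (radius H) q s.
Proof.
intros HH. apply continuity_2d_pt_mult; [| apply continuity_2d_pt_const].
apply continuity_2d_pt_plus; [apply continuity_2d_pt_id2 |].
apply continuity_2d_pt_sqrt, continuity_2d_pt_plus.
- apply continuity_2d_pt_sqr, continuity_2d_pt_id2.
- apply continuity_2d_pt_id1.
Qed.

Lemma continuity_2d_pt_height_slope (tau a H q s : R) :
  0 < H -> 0 < q -> continuity_2d_pt (height_slope tau a H) q s.
Proof.
intros HH Hq. assert (d0 := sqrt_sqr_add_gt_0 q s Hq).
assert (C := continuity_2d_pt_radius H q s HH).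
apply continuity_2d_pt_mult; [| apply continuity_2d_pt_id2].
apply continuity_2d_pt_mult.
- apply continuity_2d_pt_sqrt, continuity_2d_pt_plus.
  + now apply continuity_2d_pt_sqr.
  + apply continuity_2d_pt_sqr, continuity_2d_pt_minus;
      [| apply continuity_2d_pt_const].
    apply continuity_2d_pt_mult; [apply continuity_2d_pt_const |].
    now apply continuity_2d_pt_sqr.
- apply continuity_2d_pt_inv; [| lra].
  apply continuity_2d_pt_sqrt, continuity_2d_pt_plus.
  + apply continuity_2d_pt_sqr, continuity_2d_pt_id2.
  + apply continuity_2d_pt_id1.
Qed.

Lemma continuous_height_slope (tau a H q s : R) :
  0 < H -> 0 < q -> continuous (height_slope tau a H q) s.
Proof.
intros HH Hq. now apply continuity_2d_pt_section, continuity_2d_pt_height_slope.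
Qed.

(* The paper's [delta_a(H, J)], folded onto a quarter turn. *)
Definition closing_defect (tau a H q : R) : R :=
  RInt (fun u => height_slope tau a H q (sin u) + height_slope tau a H q (- sin u))
    0 (PI / 2).

(** Radius and slope depend on [sigma] only through its sine, the radius injectively and the slope
    with the same sign, so the criterion for closed curves applies. *)
Lemma is_tube_iff (tau a H J : R) :
  0 < H -> J < 0 -> is_tube tau a H J <-> closing_defect tau a H (- 4 * H * J) = 0.
Proof.
intros HH HJ.
set (q := - 4 * H * J). assert (Hq : 0 < q) by (unfold q; nra).
assert (Hslope := fun s => continuous_height_slope tau a H q s HH Hq).
assert (Hpos : forall s,
  0 < orbit_speed tau a (radius H q s) / sqrt (s ^ 2 + q)).
{ intros s. apply Rdiv_lt_0_compat.
  - now apply orbit_speed_gt_0, radius_gt_0.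
  - now apply sqrt_sqr_add_gt_0. }
unfold closing_defect. rewrite <- sin_primitive_half_turn by assumption.
rewrite <- (simple_closed_curve_sin (radius H q) (height_slope tau a H q)).
- assert (E : forall t, profile_curve tau a H J t =
    (radius H q (sin t), sin_primitive (height_slope tau a H q) t)).
  { intros t. unfold profile_curve. f_equal.
    - now apply profile_rE.
    - apply (RInt_ext (V := R_CompleteNormedModule)). intros x _.
      now apply profile_dhE. }
  (* Being a simple closed curve depends only on the pointwise values, so function extensionality is
     avoided. *)
  assert (X : forall g g' : R -> R * R, (forall t, g t = g' t) ->
    simple_closed_curve g -> simple_closed_curve g').
  { intros g g' Eg [C [T [HT [Hp Hi]]]]. split.
    - intros t. now apply (continuous_ext g).
    - exists T. split; [assumption | split].
      + intros t. rewrite <- !Eg. apply Hp.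
      + intros s t Hs Ht. rewrite <- !Eg. now apply Hi. }
  split; apply X; intros t; [| symmetry]; apply E.
- intros s. now apply continuity_2d_pt_section, continuity_2d_pt_radius.
- assumption.
- intros s t. now apply radius_inj.
- intros s Hs. specialize (Hpos s). unfold height_slope. nra.
- intros s Hs. specialize (Hpos s). unfold height_slope. nra.
Qed.

Lemma continuity_2d_pt_height_slope_fold (tau a H q u : R) :
  0 < H -> 0 < q ->
  continuity_2d_pt (fun q u =>
    height_slope tau a H q (sin u) + height_slope tau a H q (- sin u)) q u.
Proof.
intros HH Hq.
assert (Hs : continuity_2d_pt (fun _ v => sin v) q u).
{ apply continuity_1d_2d_pt_comp;
    [apply continuity_pt_filterlim, continuous_sin | apply continuity_2d_pt_id2]. }
assert (X : forall g : R -> R -> R, continuity_2d_pt g q u ->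
  continuity_2d_pt (fun q u => height_slope tau a H q (g q u)) q u).
{ intros g Hg.
  apply continuity_2d_pt_filterlim.
  apply (continuous_comp_2 (fun z : R * R => fst z) (fun z => g (fst z) (snd z))
           (height_slope tau a H) (q, u)).
  - apply continuous_fst.
  - now apply continuity_2d_pt_filterlim in Hg.
  - now apply (proj1 (continuity_2d_pt_filterlim _ _ _)),
      continuity_2d_pt_height_slope. }
apply continuity_2d_pt_plus.
- now apply (X (fun _ u => sin u)).
- apply (X (fun _ u => - sin u)). now apply continuity_2d_pt_opp.
Qed.

Lemma continuous_closing_defect (tau a H q : R) :
  0 < H -> 0 < q -> continuous (closing_defect tau a H) q.
Proof.
intros HH Hq. assert (HPI := PI_RGT_0).
apply (continuous_RInt_param (fun q u =>
    height_slope tau a H q (sin u) + height_slope tau a H q (- sin u))).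
- lra.
(* The ball of radius [q] about [q] contains only positive parameters. *)
- exists (mkposreal _ Hq). intros y Hy.
  assert (Hy0 : 0 < y).
  { unfold ball in Hy; simpl in Hy; unfold AbsRing_ball, abs, minus, plus, opp in Hy.
    simpl in Hy. apply Rabs_def2 in Hy. lra. }
  apply (ex_RInt_continuous (V := R_CompleteNormedModule)). intros z _.
  now apply (continuity_2d_pt_section (fun q u =>
    height_slope tau a H q (sin u) + height_slope tau a H q (- sin u))),
    continuity_2d_pt_height_slope_fold.
- intros x _. now apply continuity_2d_pt_height_slope_fold.
Qed.

(** * Sign and monotonicity of the closing defect *)

Lemma orbit_speed_sqr (tau a r : R) :
  orbit_speed tau a r * orbit_speed tau a r = r ^ 2 + (tau * r ^ 2 - a) ^ 2.
Proof.
apply sqrt_sqrt.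
assert (0 <= r ^ 2) by apply pow2_ge_0.
assert (0 <= (tau * r ^ 2 - a) ^ 2) by apply pow2_ge_0. lra.
Qed.

(** Completing the square in [r ^ 2]: the difference of the two sides is a square that vanishes
    exactly for [r ^ 2 = rho_a ^ 2]. *)
Lemma orbit_speed_sqr_ge (tau a r : R) :
  0 < tau ->
  4 * a * tau - 1 <= 4 * tau ^ 2 * (orbit_speed tau a r * orbit_speed tau a r).
Proof.
intros Ht. rewrite orbit_speed_sqr.
assert (0 <= (2 * tau ^ 2 * r ^ 2 - (2 * a * tau - 1)) ^ 2) by apply pow2_ge_0.
nra.
Qed.

(** The last factor vanishes when the mean of the squared radii is [rho_a ^ 2]. The identity serves
    twice: for [s] against [- s] at fixed [q], and for two values of [q] at fixed [s]. *)
Lemma orbit_speed_sqr_sub (tau a r1 r2 : R) :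
  (orbit_speed tau a r2 - orbit_speed tau a r1) *
    (orbit_speed tau a r1 + orbit_speed tau a r2) =
  (r2 ^ 2 - r1 ^ 2) * (tau ^ 2 * (r1 ^ 2 + r2 ^ 2) - (2 * a * tau - 1)).
Proof.
transitivity (orbit_speed tau a r2 * orbit_speed tau a r2 -
  orbit_speed tau a r1 * orbit_speed tau a r1); [ring |].
rewrite !orbit_speed_sqr. ring.
Qed.

Lemma radius_sqr (H q s : R) :
  0 < H -> 0 < q ->
  radius H q s ^ 2 = (2 * s ^ 2 + q + 2 * s * sqrt (s ^ 2 + q)) / (4 * H ^ 2).
Proof.
intros HH Hq. assert (dd := sqrt_sqr_add_sqr q s Hq). unfold radius.
replace (((s + sqrt (s ^ 2 + q)) / (2 * H)) ^ 2)
  with ((s ^ 2 + 2 * s * sqrt (s ^ 2 + q) + sqrt (s ^ 2 + q) * sqrt (s ^ 2 + q))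
    / (4 * H ^ 2)) by (field; lra).
rewrite dd. f_equal. ring.
Qed.

(* The value of [q] at which the circle [sin sigma = 0] has the radius [rho_a] of
   the geodesic [c_a]: [q = 4 H^2 rho_a^2]. *)
Definition geodesic_q (tau a H : R) : R :=
  2 * H ^ 2 * (2 * a * tau - 1) / tau ^ 2.

Definition speed_sum (tau a H q s : R) : R :=
  orbit_speed tau a (radius H q s) + orbit_speed tau a (radius H q (- s)).

Lemma speed_sum_gt_0 (tau a H q s : R) :
  0 < H -> 0 < q -> 0 < speed_sum tau a H q s.
Proof.
intros HH Hq. apply Rplus_lt_0_compat; now apply orbit_speed_gt_0, radius_gt_0.
Qed.

(** Rationalizing [F(r_+) - F(r_-)]: since [r_+ ^ 2 - r_- ^ 2 = s * d / H ^ 2] with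
    [d = sqrt (s ^ 2 + q)], the denominator [d] of the slope cancels. *)
Lemma height_slope_fold (tau a H q s : R) :
  0 < tau -> 0 < H -> 0 < q ->
  height_slope tau a H q s + height_slope tau a H q (- s) =
  tau ^ 2 * s ^ 2 / (2 * H ^ 4) *
    ((2 * s ^ 2 + q - geodesic_q tau a H) / speed_sum tau a H q s).
Proof.
intros Ht HH Hq.
assert (G0 := speed_sum_gt_0 tau a H q s HH Hq).
assert (d0 := sqrt_sqr_add_gt_0 q s Hq).
assert (D := orbit_speed_sqr_sub tau a (radius H q (- s)) (radius H q s)).
rewrite !radius_sqr in D by assumption.
unfold height_slope, geodesic_q. unfold speed_sum in *.
replace ((- s) ^ 2) with (s ^ 2) in * by ring.
set (d := sqrt _) in *.
set (Fp := orbit_speed tau a (radius H q s)) in *.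
set (Fm := orbit_speed tau a (radius H q (- s))) in *.
assert (E : Fp - Fm = s * d / H ^ 2 *
  (tau ^ 2 * (2 * s ^ 2 + q) / (2 * H ^ 2) - (2 * a * tau - 1)) / (Fp + Fm)).
{ apply (Rmult_eq_reg_r (Fm + Fp)); [| lra].
  rewrite D. field. lra. }
replace (Fp / d * s + Fm / d * - s) with ((Fp - Fm) * s / d) by (field; lra).
rewrite E. field. lra.
Qed.

(** * Dependence of the folded integrand on [q] *)

Lemma sqrt_sqr_add_incr (q1 q2 s : R) :
  1 <= q1 <= q2 ->
  0 <= 2 * (sqrt (s ^ 2 + q2) - sqrt (s ^ 2 + q1)) <= q2 - q1.
Proof.
intros Hq.
assert (0 <= s ^ 2) by apply pow2_ge_0.
assert (A : 1 <= sqrt (s ^ 2 + q1)) by (rewrite <- sqrt_1; apply sqrt_le_1; lra).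
assert (B : sqrt (s ^ 2 + q1) <= sqrt (s ^ 2 + q2)) by (apply sqrt_le_1; lra).
(* The difference of the roots times their sum is [q2 - q1], and the sum is at least 2. *)
assert (dd1 := sqrt_sqr_add_sqr q1 s). assert (dd2 := sqrt_sqr_add_sqr q2 s).
nra.
Qed.

Lemma radius_sqr_incr (H q1 q2 s : R) :
  0 < H -> s ^ 2 <= 1 -> 1 <= q1 <= q2 ->
  Rabs (radius H q2 s ^ 2 - radius H q1 s ^ 2) <= (q2 - q1) / (2 * H ^ 2).
Proof.
intros HH Hs Hq.
assert (D := sqrt_sqr_add_incr q1 q2 s Hq).
rewrite !radius_sqr by lra.
set (d1 := sqrt (s ^ 2 + q1)) in *. set (d2 := sqrt (s ^ 2 + q2)) in *.
replace (_ - _) with ((q2 - q1 + 2 * s * (d2 - d1)) / (4 * H ^ 2))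
  by (field; lra).
replace ((q2 - q1) / (2 * H ^ 2)) with (2 * (q2 - q1) / (4 * H ^ 2))
  by (field; lra).
assert (H2 : 0 < / (4 * H ^ 2)) by (apply Rinv_0_lt_compat; nra).
assert (Hs' : -1 <= s <= 1) by nra.
assert (S : - (d2 - d1) <= s * (d2 - d1) <= d2 - d1) by nra.
apply Rabs_le. unfold Rdiv. split.
- rewrite Ropp_mult_distr_l. apply Rmult_le_compat_r; lra.
- apply Rmult_le_compat_r; lra.
Qed.

Lemma radius_sqr_le (H q s : R) :
  0 < H -> s ^ 2 <= 1 -> 0 < q -> radius H q s ^ 2 <= (1 + q) / H ^ 2.
Proof.
intros HH Hs Hq. rewrite radius_sqr by assumption.
assert (dd := sqrt_sqr_add_sqr q s Hq). set (d := sqrt _) in *.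
replace ((1 + q) / H ^ 2) with ((4 * (1 + q)) / (4 * H ^ 2)) by (field; lra).
apply Rmult_le_compat_r.
- apply Rlt_le, Rinv_0_lt_compat. nra.
- assert (0 <= (s - d) ^ 2) by apply pow2_ge_0. nra.
Qed.

(* [orbit_speed ^ 2] is a Lipschitz function of [r ^ 2] on bounded sets and
   [orbit_speed] is bounded below, while [r ^ 2] moves by [O(1 / H ^ 2)]. *)
Lemma orbit_speed_variation (tau a H q1 q2 s : R) :
  0 < tau -> 0 < 2 * a * tau - 1 -> 1 <= H ->
  4 * tau ^ 2 * (2 * tau ^ 2 + 5 * (2 * a * tau - 1)) <
    H ^ 2 * (4 * a * tau - 1) ->
  s ^ 2 <= 1 -> 1 <= q1 -> q1 < q2 <= geodesic_q tau a H ->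
  2 * Rabs (orbit_speed tau a (radius H q2 s) - orbit_speed tau a (radius H q1 s))
    < (q2 - q1) * orbit_speed tau a (radius H q1 s).
Proof.
intros Ht Hm HH Hlarge Hs Hq1 Hq2.
assert (HH0 : 0 < H) by lra.
assert (HH2 : 1 <= H ^ 2) by nra.
assert (Ht2 : 0 < tau ^ 2) by nra.
assert (dx := radius_sqr_incr H q1 q2 s HH0 Hs ltac:(lra)).
(* Up to [geodesic_q] the parameter [q] is at most a multiple of [H ^ 2], so the radii are bounded
   independently of [H >= 1]. *)
assert (X : forall q, 1 <= q <= geodesic_q tau a H ->
  tau ^ 2 * radius H q s ^ 2 <= tau ^ 2 + 2 * (2 * a * tau - 1)).
{ intros q Hq.
  assert (B := radius_sqr_le H q s HH0 Hs ltac:(lra)).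
  assert (B2 : (1 + q) / H ^ 2 <= 1 + 2 * (2 * a * tau - 1) / tau ^ 2).
  { apply (Rmult_le_reg_r (H ^ 2)); [lra |].
    replace ((1 + q) / H ^ 2 * H ^ 2) with (1 + q) by (field; lra).
    replace ((1 + 2 * (2 * a * tau - 1) / tau ^ 2) * H ^ 2)
      with (H ^ 2 + geodesic_q tau a H) by (unfold geodesic_q; field; lra).
    lra. }
  replace (tau ^ 2 + 2 * (2 * a * tau - 1))
    with (tau ^ 2 * (1 + 2 * (2 * a * tau - 1) / tau ^ 2)) by (field; lra).
  apply Rmult_le_compat_l; lra. }
assert (X1 := X q1 ltac:(lra)). assert (X2 := X q2 ltac:(lra)).
assert (D := orbit_speed_sqr_sub tau a (radius H q1 s) (radius H q2 s)).
assert (L := orbit_speed_sqr_ge tau a (radius H q1 s) Ht).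
assert (P1 := orbit_speed_gt_0 tau a _ (radius_gt_0 H q1 s HH0 ltac:(lra))).
assert (P2 := orbit_speed_gt_0 tau a _ (radius_gt_0 H q2 s HH0 ltac:(lra))).
set (F1 := orbit_speed tau a (radius H q1 s)) in *.
set (F2 := orbit_speed tau a (radius H q2 s)) in *.
assert (0 <= radius H q1 s ^ 2) by apply pow2_ge_0.
assert (0 <= radius H q2 s ^ 2) by apply pow2_ge_0.
set (x1 := radius H q1 s ^ 2) in *. set (x2 := radius H q2 s ^ 2) in *.
set (M := 2 * tau ^ 2 + 5 * (2 * a * tau - 1)) in *.
(* The two radius bounds add up to [2 * tau ^ 2 + 4 * (2 * a * tau - 1)]; the subtracted term raises
   the coefficient 4 to 5 in [M]. *)
assert (Y : Rabs (tau ^ 2 * (x1 + x2) - (2 * a * tau - 1)) <= M).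
{ apply Rabs_le. unfold M. split; nra. }
apply (f_equal Rabs) in D. rewrite !Rabs_mult in D.
rewrite (Rabs_pos_eq (F1 + F2)) in D by lra.
assert (B : Rabs (F2 - F1) * (F1 + F2) <= (q2 - q1) / (2 * H ^ 2) * M).
{ rewrite D. apply Rmult_le_compat; try assumption; apply Rabs_pos. }
(* This is where [H] must be large: the lower bound of [orbit_speed_sqr_ge] beats [M / H ^ 2]. *)
assert (HM : M / H ^ 2 < F1 * F1).
{ apply (Rmult_lt_reg_r (4 * tau ^ 2 * H ^ 2)); [nra |].
  replace (M / H ^ 2 * (4 * tau ^ 2 * H ^ 2)) with (4 * tau ^ 2 * M)
    by (field; lra).
  nra. }
apply (Rmult_lt_reg_r (F1 + F2)); [lra |].
replace ((q2 - q1) / (2 * H ^ 2) * M) with ((q2 - q1) * (M / H ^ 2) / 2) in B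
  by (field; lra).
assert (Z : (q2 - q1) * (M / H ^ 2) < (q2 - q1) * (F1 * (F1 + F2))).
{ apply Rmult_lt_compat_l; nra. }
nra.
Qed.

Lemma height_slope_fold_incr (tau a H q1 q2 s : R) :
  0 < tau -> 0 < 2 * a * tau - 1 -> 1 <= H ->
  4 * tau ^ 2 * (2 * tau ^ 2 + 5 * (2 * a * tau - 1)) <
    H ^ 2 * (4 * a * tau - 1) ->
  0 < s <= 1 -> 1 <= q1 -> geodesic_q tau a H - 2 <= q1 ->
  q1 < q2 <= geodesic_q tau a H ->
  height_slope tau a H q1 s + height_slope tau a H q1 (- s) <
  height_slope tau a H q2 s + height_slope tau a H q2 (- s).
Proof.
intros Ht Hm HH Hlarge Hs Hq1 Hq1c Hq2.
assert (HH0 : 0 < H) by lra.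
assert (Hs2 : 0 < s ^ 2 <= 1) by nra.
rewrite !height_slope_fold by lra.
apply Rmult_lt_compat_l.
{ apply Rdiv_lt_0_compat.
  - apply Rmult_lt_0_compat; [nra | lra].
  - assert (0 < H ^ 4) by now apply pow_lt. lra. }
assert (V1 := orbit_speed_variation tau a H q1 q2 s Ht Hm HH Hlarge
                ltac:(lra) Hq1 Hq2).
assert (V2 := orbit_speed_variation tau a H q1 q2 (- s) Ht Hm HH Hlarge
                ltac:(nra) Hq1 Hq2).
assert (G1 := speed_sum_gt_0 tau a H q1 s HH0 ltac:(lra)).
assert (G2 := speed_sum_gt_0 tau a H q2 s HH0 ltac:(lra)).
assert (V : 2 * Rabs (speed_sum tau a H q2 s - speed_sum tau a H q1 s) <
  (q2 - q1) * speed_sum tau a H q1 s).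
{ unfold speed_sum.
  replace (_ + _ - _) with
    ((orbit_speed tau a (radius H q2 s) - orbit_speed tau a (radius H q1 s)) +
     (orbit_speed tau a (radius H q2 (- s)) - orbit_speed tau a (radius H q1 (- s))))
    by ring.
  eapply Rle_lt_trans; [apply Rmult_le_compat_l, Rabs_triang; lra |]. lra. }
set (A1 := speed_sum tau a H q1 s) in *. set (A2 := speed_sum tau a H q2 s) in *.
set (c := geodesic_q tau a H) in *.
(* After clearing denominators the claim is [(2 * s ^ 2 + q1 - c) * (A2 - A1) < (q2 - q1) * A1].
   Since [c - 2 <= q1 < c] and [s ^ 2 <= 1], the first factor has absolute value at most 2, and [V]
   concludes. *)
assert (W : (2 * s ^ 2 + q1 - c) * (A2 - A1) <= 2 * Rabs (A2 - A1)).
{ eapply Rle_trans; [apply Rle_abs |]. rewrite Rabs_mult.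
  apply Rmult_le_compat_r; [apply Rabs_pos |]. apply Rabs_le. lra. }
apply (Rmult_lt_reg_r (A1 * A2)); [now apply Rmult_lt_0_compat |].
replace ((2 * s ^ 2 + q1 - c) / A1 * (A1 * A2))
  with ((2 * s ^ 2 + q1 - c) * A2) by (field; lra).
replace ((2 * s ^ 2 + q2 - c) / A2 * (A1 * A2))
  with ((2 * s ^ 2 + q2 - c) * A1) by (field; lra).
lra.
Qed.

(** * From the folded integrand to its integral *)

Lemma continuous_height_slope_fold (tau a H q u : R) :
  0 < H -> 0 < q ->
  continuous (fun u =>
    height_slope tau a H q (sin u) + height_slope tau a H q (- sin u)) u.
Proof.
intros HH Hq.
now apply (continuity_2d_pt_section (fun q u =>
  height_slope tau a H q (sin u) + height_slope tau a H q (- sin u))),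
  continuity_2d_pt_height_slope_fold.
Qed.

Lemma sin_quarter (u : R) : 0 < u < PI / 2 -> 0 < sin u < 1.
Proof.
intros Hu. split.
- apply sin_gt_0; lra.
- rewrite <- sin_PI2. apply sin_increasing_1; lra.
Qed.

Lemma closing_defect_gt_0 (tau a H q : R) :
  0 < tau -> 0 < H -> 0 < q -> geodesic_q tau a H <= q ->
  0 < closing_defect tau a H q.
Proof.
intros Ht HH Hq Hc. assert (HPI := PI_RGT_0). apply RInt_gt_0.
- lra.
- intros u Hu. apply sin_quarter in Hu. rewrite height_slope_fold by assumption.
  assert (0 < H ^ 4) by now apply pow_lt.
  assert (0 < tau ^ 2) by now apply pow_lt.
  assert (0 < sin u ^ 2) by (apply pow_lt; lra).
  apply Rmult_lt_0_compat; apply Rdiv_lt_0_compat; try nra.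
  now apply speed_sum_gt_0.
- intros u _. now apply continuous_height_slope_fold.
Qed.

(** Even at [q = c - 2] the integrand is negative inside the quarter turn, because there
    [sin u < 1]. *)
Lemma closing_defect_lt_0 (tau a H q : R) :
  0 < tau -> 0 < H -> 0 < q -> q <= geodesic_q tau a H - 2 ->
  closing_defect tau a H q < 0.
Proof.
intros Ht HH Hq Hc. assert (HPI := PI_RGT_0).
replace 0 with (RInt (fun _ => 0) 0 (PI / 2))
  by (rewrite RInt_const; apply Rmult_0_r).
apply RInt_lt.
- lra.
- intros u _. apply continuous_const.
- intros u _. now apply continuous_height_slope_fold.
- intros u Hu. apply sin_quarter in Hu. rewrite height_slope_fold by assumption.
  assert (G := speed_sum_gt_0 tau a H q (sin u) HH Hq).
  apply Rinv_0_lt_compat in G.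
  assert (0 < H ^ 4) by now apply pow_lt.
  assert (0 < tau ^ 2) by now apply pow_lt.
  assert (0 < sin u ^ 2 < 1) by nra.
  assert (0 < tau ^ 2 * sin u ^ 2 / (2 * H ^ 4))
    by (apply Rdiv_lt_0_compat; nra).
  unfold Rdiv at 2.
  assert ((2 * sin u ^ 2 + q - geodesic_q tau a H) *
    / speed_sum tau a H q (sin u) < 0) by nra.
  nra.
Qed.

Lemma closing_defect_incr (tau a H q1 q2 : R) :
  0 < tau -> 0 < 2 * a * tau - 1 -> 1 <= H ->
  4 * tau ^ 2 * (2 * tau ^ 2 + 5 * (2 * a * tau - 1)) <
    H ^ 2 * (4 * a * tau - 1) ->
  1 <= q1 -> geodesic_q tau a H - 2 <= q1 -> q1 < q2 <= geodesic_q tau a H ->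
  closing_defect tau a H q1 < closing_defect tau a H q2.
Proof.
intros Ht Hm HH Hlarge Hq1 Hq1c Hq2. assert (HPI := PI_RGT_0).
apply RInt_lt.
- lra.
- intros u _. apply continuous_height_slope_fold; lra.
- intros u _. apply continuous_height_slope_fold; lra.
- intros u Hu. apply sin_quarter in Hu.
  apply height_slope_fold_incr; try assumption; lra.
Qed.

(** * The unique root and the threshold for [H] *)

Lemma closing_defect_unique_root (tau a H : R) :
  0 < tau -> 0 < 2 * a * tau - 1 -> 1 <= H ->
  4 * tau ^ 2 * (2 * tau ^ 2 + 5 * (2 * a * tau - 1)) <
    H ^ 2 * (4 * a * tau - 1) ->
  3 <= geodesic_q tau a H ->
  exists! q : R, 0 < q /\ closing_defect tau a H q = 0.
Proof.
intros Ht Hm HH Hlarge Hc. assert (HH0 : 0 < H) by lra.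
(* Every root lies in the window between [c - 2] and [c]. By [3 <= c] this window is contained in
   [q >= 1], where monotonicity is available. *)
assert (B : forall q, 0 < q -> closing_defect tau a H q = 0 ->
  geodesic_q tau a H - 2 < q < geodesic_q tau a H).
{ intros q Hq E. split; apply Rnot_le_lt; intros Hle.
  - assert (N := closing_defect_lt_0 tau a H q Ht HH0 Hq Hle). lra.
  - assert (N := closing_defect_gt_0 tau a H q Ht HH0 Hq Hle). lra. }
destruct (Ranalysis5.IVT_interv (closing_defect tau a H)
  (geodesic_q tau a H - 2) (geodesic_q tau a H)) as [q [Hq E]].
- intros q Hq. apply continuity_pt_filterlim, continuous_closing_defect; lra.
- lra.
- apply closing_defect_lt_0; lra.
- apply closing_defect_gt_0; lra.
- exists q. split; [split; [lra | exact E] |].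
  intros q' [Hq' E']. apply B in E'  as B'; [| exact Hq'].
  destruct (Rtotal_order q q') as [L | [-> | L]]; [| reflexivity |].
  + assert (I := closing_defect_incr tau a H q q' Ht Hm HH Hlarge). lra.
  + assert (I := closing_defect_incr tau a H q' q Ht Hm HH Hlarge). lra.
Qed.

Theorem theorem3p11 (tau a : R) (htau : 0 < tau) (ha : 1 / (2 * tau) < a) :
  exists Hcrit : R,
    forall H : R, 0 < H -> Hcrit < H ->
      exists! J : R, J < 0 /\ is_tube tau a H J.
Proof.
assert (Hm : 0 < 2 * a * tau - 1).
{ apply (Rmult_lt_compat_r (2 * tau)) in ha; [| lra].
  replace (1 / (2 * tau) * (2 * tau)) with 1 in ha by (field; lra). lra. }
assert (Ht2 : 0 < tau ^ 2) by now apply pow_lt.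
(* [H ^ 2 >= B1] amounts to [3 <= geodesic_q tau a H], and [H ^ 2 > B2] to the largeness condition
   of the monotonicity estimate. *)
set (B1 := 3 * tau ^ 2 / (2 * (2 * a * tau - 1))).
set (B2 := 4 * tau ^ 2 * (2 * tau ^ 2 + 5 * (2 * a * tau - 1)) /
  (4 * a * tau - 1)).
assert (HB1 : 0 < B1) by (apply Rdiv_lt_0_compat; lra).
assert (HB2 : 0 < B2) by (apply Rdiv_lt_0_compat; nra).
(* The summand 1 gives [H > 1], so [H ^ 2] exceeds [H] and with it both bounds. *)
exists (1 + B1 + B2). intros H HH Hcrit.
assert (HB : 1 + B1 + B2 < H ^ 2) by nra.
destruct (closing_defect_unique_root tau a H) as [q [[Hq E] U]];
  try assumption; try lra.
- replace (4 * tau ^ 2 * (2 * tau ^ 2 + 5 * (2 * a * tau - 1)))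
    with (B2 * (4 * a * tau - 1)) by (unfold B2; field; lra).
  apply Rmult_lt_compat_r; lra.
- replace (geodesic_q tau a H)
    with (H ^ 2 * (2 * (2 * a * tau - 1) / tau ^ 2))
    by (unfold geodesic_q; field; lra).
  replace 3 with (B1 * (2 * (2 * a * tau - 1) / tau ^ 2)) by (unfold B1; field; lra).
  apply Rmult_le_compat_r; [| lra].
  apply Rlt_le, Rdiv_lt_0_compat; lra.
(* For fixed [H], [q = - 4 * H * J] is a bijection between [J < 0] and [q > 0], so existence and
   uniqueness carry over. *)
- assert (EJ : - 4 * H * (- q / (4 * H)) = q) by (field; lra).
  assert (HJ : - q / (4 * H) < 0).
  { assert (0 < q / (4 * H)) by (apply Rdiv_lt_0_compat; lra). lra. }
  exists (- q / (4 * H)). split.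
  + split; [exact HJ |]. apply is_tube_iff; [assumption .. |]. now rewrite EJ.
  + intros J [HJ' Htube]. apply is_tube_iff in Htube; [| assumption ..].
    rewrite (U (- 4 * H * J)); [field; lra |].
    split; [nra | exact Htube].
Qed.
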